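(* Let $D$ be a strong s-quadrangular digraph with at least two vertices in which every vertex has out-degree at most 3 and in-degree at most 3. Then $D$ is hamiltonian, i.e. $D$ has a directed cycle passing through every vertex exactly once.
   Context: All digraphs are finite, without loops or multiple arcs. For $x\neq y$, $x$ dominates $y$ if $xy$ is an arc. $N^+(x)$ is the set of vertices dominated by $x$ and $N^-(x)$ the set of vertices dominating $x$; the out-degree and in-degree of $x$ are $|N^+(x)|$ and $|N^-(x)|$. A vertex set $S$ is a $q^+$-set ($q^-$-set, respectively) if $|S|\ge 2$ and for every $u\in S$ there is $v\in S$, $v\neq u$, with $N^+(u)\cap N^+(v)\neq\emptyset$ ($N^-(u)\cap N^-(v)\neq\emptyset$, respectively). $D$ is s-quadrangular if for every $q^+$-set $S$, $\left|\bigcup\{N^+(u)\cap N^+(v): u\neq v,\ u,v\in S\}\right|\ge |S|$, and for every $q^-$-set $S$, $\left|\bigcup\{N^-(u)\cap N^-(v): u\neq v,\ u,v\in S\}\right|\ge |S|$. $D$ is strong if for every ordered pair $x,y$ of vertices there is a directed path from $x$ to $y$. *)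

(* Defs.v *)
(* A finite digraph without loops or multiple arcs is an
   irreflexive relation e on a finType, e x y meaning that xy is an arc;
   opposite arcs xy and yx may coexist. *)
From mathcomp Require Import all_boot.

Set Implicit Arguments.
Unset Strict Implicit.
Unset Printing Implicit Defensive.

Definition out_nbr (T : finType) (e : rel T) (x : T) : {set T} :=
  [set y | e x y].

Definition in_nbr (T : finType) (e : rel T) (x : T) : {set T} :=
  [set y | e y x].

(* In the next three definitions, N is out_nbr e for the q^+ notions and
   in_nbr e for the q^- notions. *)
Definition qset (T : finType) (N : T -> {set T}) (S : {set T}) : Prop :=
  2 <= #|S| /\
  forall u, u \in S ->
    exists v, [/\ v \in S, v != u & N u :&: N v != set0].

Definition common_nbrs (T : finType) (N : T -> {set T}) (S : {set T})
  : {set T} :=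
  \bigcup_(u in S) \bigcup_(v in S | u != v) (N u :&: N v).

Definition quadrangular_for (T : finType) (N : T -> {set T}) : Prop :=
  forall S : {set T}, qset N S -> #|S| <= #|common_nbrs N S|.

Definition s_quadrangular (T : finType) (e : rel T) : Prop :=
  quadrangular_for (out_nbr e) /\ quadrangular_for (in_nbr e).

Definition strong (T : finType) (e : rel T) : Prop :=
  forall x y : T, connect e x y.

(* MathComp's cycle accepts the empty sequence and, at a loop, a singleton;
   neither can occur here when e is irreflexive and T is nonempty. *)
Definition hamiltonian (T : finType) (e : rel T) : Prop :=
  exists c : seq T, [/\ cycle e c, uniq c & forall x : T, x \in c].

(* Main.v *)
Require Import Defs.
From mathcomp Require Import all_boot fingroup perm.

(* Join x to y^i when xy is an arc, giving a bipartite graph. Hall's condition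
   follows from quadrangularity, so there is a permutation [s] of the vertices
   along arcs, that is, a cycle factor; take one whose orbits connect as many
   pairs of vertices as possible. The relation [M x y := e x (s y)] is
   reflexive, and its components turn out to be K_{1,1}, K_{2,2}, K_{3,3}
   possibly minus an edge, and K_{4,4} minus a perfect matching. In each of them
   the tails lie on a single orbit: a swap (or, in one case, a rotation of four
   images) would otherwise merge two orbits. So the ends of every arc lie on the
   same orbit, and by strong connectivity there is only one. *)

Set Implicit Arguments.
Unset Strict Implicit.
Unset Printing Implicit Defensive.

(** * Hall's marriage theorem *)

Section Hall.

Variables A B : finType.

Let nbrs (N : A -> {set B}) (X : {set A}) := \bigcup_(x in X) N x.

(** Induction on the total size of the sets [N x]: an element is deleted from a set that has at
    least two, keeping Hall's condition. Once no set has two elements, all are singletons, and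
    Hall's condition on pairs makes the choice injective. *)
Lemma hall (N : A -> {set B}) :
  (forall X : {set A}, #|X| <= #|\bigcup_(x in X) N x|) ->
  exists2 f : A -> B, injective f & forall x, f x \in N x.
Proof.
have [n] := ubnP (\sum_x #|N x|); elim: n N => // n IHn N leNn hallN.
have [/forallP N1 | /forallPn[x]] := boolP [forall x, #|N x| <= 1].
  have N_eq x : {y | N x = [set y]}.
    have [y /= Ny | N0] := pickP (mem (N x)).
      exists y; apply/esym/eqP; rewrite eqEcard sub1set Ny cards1; exact: N1.
    suff: false by [].
    have := hallN [set x]; rewrite big_set1 cards1 lt0n cards_eq0.
    by case/negP; apply/eqP/setP=> y; rewrite inE; apply: N0.
  exists (fun x => sval (N_eq x)) => [x1 x2 eq_f | x]; last first.
    by case: (N_eq x) => y /= ->; rewrite set11.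
  apply/eqP/negPn/negP=> x12; have := hallN [set x1; x2].
  rewrite cards2 x12 big_setU1 ?inE //= big_set1.
  by rewrite (svalP (N_eq x1)) (svalP (N_eq x2)) eq_f setUid cards1.
rewrite -ltnNge => /card_gt1P[a [b [Na Nb ab]]].
pose N' c z := if z == x then N x :\ c else N z.
have N'E c z : z != x -> N' c z = N z by rewrite /N' => /negPf->.
have N'x c : N' c x = N x :\ c by rewrite /N' eqxx.
(* Rado: if deleting xa and deleting xb violate Hall's condition at X and at Y,
   then submodularity of |N(_)| contradicts it at X u Y u {x} and X n Y. *)
have step c : c \in N x ->
    (exists2 f : A -> B, injective f & forall z, f z \in N z) \/
    exists2 X : {set A}, x \notin X & #|nbrs N X :|: (N x :\ c)| <= #|X|.
  move=> Nc.
  have [/forallP hall' | /forallPn[X]] :=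
    boolP [forall X : {set A}, #|X| <= #|\bigcup_(z in X) N' c z|].
    left; have [|f f_inj fN] := IHn (N' c) _ hall'.
      rewrite ltnS in leNn; apply: leq_trans leNn.
      rewrite (bigD1 x) //= [X in _ < X](bigD1 x) //= N'x.
      rewrite (cardsD1 c (N x)) Nc -addnA ltnS leq_add2l.
      by apply: leq_sum => z zx; rewrite N'E.
    exists f => // z; have := fN z; rewrite /N'; case: eqP => // ->.
    by case/setD1P.
  rewrite -ltnNge => ltX; right.
  (* [N'] differs from [N] only at [x], so a set violating Hall's condition for [N'] contains [x];
     removing [x] from it turns the strict inequality into a weak one. *)
  have xX : x \in X.
    apply: contraLR ltX => xX; rewrite -leqNgt.
    rewrite (eq_bigr N) // => z zX; apply: N'E.
    by apply: contraNneq xX => <-.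
  exists (X :\ x); first by rewrite !inE eqxx.
  move: ltX; rewrite (cardsD1 x X) xX ltnS; congr (_ <= _).
  rewrite (big_setD1 x) //= N'x setUC; congr #|_ :|: _|.
  by apply: eq_bigr => z /setD1P[zx _]; rewrite N'E.
have [//|[X xX leX]] := step a Na; have [//|[Y xY leY]] := step b Nb.
have := leq_add leX leY; rewrite -cardsUI -[X in _ <= X]cardsUI.
rewrite leqNgt => /negP[]; rewrite -addSn; apply: leq_add.
  have := hallN (x |: (X :|: Y)); rewrite cardsU1 inE negb_or xX xY add1n.
  move/leq_trans; apply; apply/subset_leq_card/bigcupsP => z.
  rewrite !inE => /or3P[/eqP-> | zX | zY]; apply/subsetP=> u Nu; rewrite !inE.
  (* Since [a] and [b] differ, each element of [N x] survives one of the two deletions. *)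
  - by rewrite Nu !andbT; case: (eqVneq u a) => [->|]; rewrite ?ab ?orbT.
  - suff ->: u \in nbrs N X by [].
    by apply/bigcupP; exists z.
  - suff ->: u \in nbrs N Y by rewrite orbT.
    by apply/bigcupP; exists z.
apply: leq_trans (hallN (X :&: Y)) _; apply/subset_leq_card/bigcupsP => z.
case/setIP=> zX zY; apply/subsetP=> u Nu; rewrite !inE.
by apply/andP; split; apply/orP; left; apply/bigcupP; exists z.
Qed.

End Hall.

(** * Quadrangularity: common neighbours and Hall's condition *)

Section Quadrangular.

Variables (T : finType) (N : T -> {set T}).
Hypothesis quadN : quadrangular_for N.

(** Because of [a], the pair of [x] and [y] is a q-set, so it has at least two common neighbours. *)
Lemma quadrangular_second_common x y a :
    x != y -> a \in N x -> a \in N y ->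
  exists b, [/\ b != a, b \in N x & b \in N y].
Proof.
move=> xy ax ay; have aI : a \in N x :&: N y by rewrite inE ax.
have : qset N [set x; y].
  split=> [|u]; first by rewrite cards2 xy.
  rewrite !inE => /orP[] /eqP->; [exists y | exists x]; rewrite !inE eqxx ?orbT.
    by split; [| rewrite eq_sym | apply/set0Pn; exists a].
  by split=> //; apply/set0Pn; exists a; rewrite setIC.
move/quadN; rewrite cards2 xy => le2.
have /card_gt1P[b [c [bI cI bc]]] : 1 < #|N x :&: N y|.
  apply: leq_trans le2 _; apply/subset_leq_card/bigcupsP => u uS.
  apply/bigcupsP => v /andP[vS uv]; move: uS vS uv; rewrite !inE.
  by move=> /orP[]/eqP-> /orP[]/eqP->; rewrite ?eqxx // setIC.
have [ba | ba] := eqVneq b a; last by exists b; case/setIP: bI.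
by exists c; case/setIP: cI; rewrite -ba eq_sym.
Qed.

(** Quadrangularity handles the set [Y] of members of [X] that share a neighbour with another
    member. Each remaining member adds a neighbour of its own, adjacent to no other member of
    [X]. *)
Lemma quadrangular_hall :
    (forall x, N x != set0) ->
  forall X : {set T}, #|X| <= #|\bigcup_(x in X) N x|.
Proof.
move=> N0 X.
pose Y := [set x in X | [exists y in X, (y != x) && (N x :&: N y != set0)]].
have YX : Y \subset X by apply/subsetP=> x; rewrite inE => /andP[].
have Yquad : #|Y| <= #|common_nbrs N Y|.
  (* An empty [Y] is no q-set; a nonempty one has two elements, since partners lie in [Y] too. *)
  have [-> | [x Yx]] := set_0Vmem Y; first by rewrite cards0.
  have qY u : u \in Y ->
      exists v, [/\ v \in Y, v != u & N u :&: N v != set0].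
    rewrite inE => /andP[Xu /exists_inP[v Xv /andP[vu uv]]].
    exists v; split=> //; rewrite inE Xv; apply/exists_inP; exists u => //.
    by rewrite eq_sym vu setIC.
  apply: quadN; split=> //; have [v [Yv vx _]] := qY x Yx.
  by apply/card_gt1P; exists v, x.
(* The default [x] never occurs, as [N x] is nonempty. *)
pose f x := odflt x [pick y in N x].
have fN x : f x \in N x.
  rewrite /f; case: pickP => //= Nx0; case/set0Pn: (N0 x) => y.
  by have := Nx0 y; rewrite /= => ->.
have lonely x y u : x \in X :\: Y -> y \in X -> u \in N x -> u \in N y -> x = y.
  case/setDP=> Xx; rewrite inE Xx => /exists_inPn/= nY Xy ux uy.
  apply/eqP/negPn/negP=> xy; have := nY y Xy; rewrite eq_sym xy /=.
  by case/negP; apply/set0Pn; exists u; rewrite inE ux.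
have f_inj : {in X :\: Y &, injective f}.
  move=> x y XYx /setDP[Xy _] eq_f; apply: (lonely x y (f x)) => //.
  by rewrite eq_f.
rewrite -(cardsID Y X) (setIidPr YX) -(card_in_imset f_inj).
apply: leq_trans (leq_add Yquad (leqnn _)) _.
rewrite -cardsUI [_ :&: _](_ : _ = set0) ?cards0 ?addn0.
  apply/subset_leq_card/subUsetP; split.
    apply/bigcupsP=> u Yu; apply/bigcupsP=> v _; apply/subsetP=> a /setIP[au _].
    by apply/bigcupP; exists u; rewrite // (subsetP YX).
  apply/subsetP=> _ /imsetP[x /setDP[Xx _] ->].
  by apply/bigcupP; exists x.
apply/setP=> a; rewrite !inE; apply/negP=> /andP[/bigcupP[u Yu]].
case/bigcupP=> v _ /setIP[au _] /imsetP[x XYx def_a].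
have xu : x = u.
  by apply: (lonely x u a); rewrite ?(subsetP YX) // def_a.
by move: XYx; rewrite xu inE Yu.
Qed.

End Quadrangular.

(** * Local structure of a reflexive relation with degrees at most three *)

Lemma le3_mem (T : finType) (A : {set T}) (a b c d : T) :
    #|A| <= 3 -> uniq [:: a; b; c] -> a \in A -> b \in A -> c \in A -> d \in A ->
  d \in [:: a; b; c].
Proof.
move=> A3 abc Aa Ab Ac Ad; apply/negPn/negP=> nd.
have /card_uniqP u4 : uniq [:: d; a; b; c] by rewrite cons_uniq nd.
have : #|[:: d; a; b; c]| <= #|A|.
  by apply/subset_leq_card/subsetP=> u; rewrite !inE => /or4P[]/eqP->.
by rewrite u4 /= => /leq_trans/(_ A3).
Qed.

Section LocalStructure.

Variables (T : finType) (M : rel T).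
Hypothesis Mrefl : reflexive M.
Hypothesis out3 : forall x, #|[set y | M x y]| <= 3.
Hypothesis in3 : forall x, #|[set y | M y x]| <= 3.
Hypothesis Mout : forall x y a, x != y -> M x a -> M y a ->
  exists b, [/\ b != a, M x b & M y b].
Hypothesis Min : forall x y a, x != y -> M a x -> M a y ->
  exists b, [/\ b != a, M b x & M b y].

(* In the last case the component of [M] is the complement of a perfect
   matching in K_{4,4}; the first two cover all the smaller components. *)
Lemma subcubic_quadrangular_arc x y : M x y ->
  [\/ M y x,
      exists z, [/\ M x z, M z x, M y z & M z y]
    | exists z w, [/\ uniq [:: x; y; z; w],
        M x z /\ M z x, M y w /\ M w y & [/\ M y z, M z w & M w x]]].
Proof.
move=> Mxy; have [|nMyx] := boolP (M y x); first by constructor 1.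
have xy : x != y by apply: contraNneq nMyx => ->.
have yx : y != x by rewrite eq_sym.
(* By reflexivity [y] is itself a common out-neighbour of [x] and [y], and [z] is a second one;
   dually, [w] is a common in-neighbour besides [x]. *)
have [z [zy Mxz Myz]] := Mout xy Mxy (Mrefl y).
have zx : z != x by apply: contraNneq nMyx => <-.
have [w [wx Mwx Mwy]] := Min xy (Mrefl x) Mxy.
have wy : w != y by apply: contraNneq nMyx => <-.
have [wz | wz] := eqVneq w z.
  by constructor 2; exists z; rewrite -{2 4}wz.
(* From here on [w] and [z] differ. Three known neighbours exhaust a degree bound, which leaves a
   single candidate for each further second common neighbour. *)
have outx d : M x d -> d \in [:: x; y; z].
  move=> Mxd; apply: (le3_mem (out3 x)); rewrite ?inE //=.
  by rewrite !inE negb_or xy eq_sym zx eq_sym zy.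
have outw d : M w d -> d \in [:: w; x; y].
  move=> Mwd; apply: (le3_mem (out3 w)); rewrite ?inE //=.
  by rewrite !inE negb_or wx wy xy.
have iny d : M d y -> d \in [:: x; y; w].
  move=> Mdy; apply: (le3_mem (in3 y)); rewrite ?inE //=.
  by rewrite !inE negb_or xy eq_sym wx eq_sym wy.
have nMzy : ~~ M z y.
  by apply/negP=> /iny; rewrite !inE (negPf zx) (negPf zy) eq_sym (negPf wz).
have Myw : M y w.
  have wy' : y != w by rewrite eq_sym.
  have [b [/negPf b_y Myb /outw]] := Mout wy' (Mrefl y) Mwy.
  rewrite !inE b_y orbF => /orP[]/eqP def_b; first by rewrite -def_b.
  by rewrite -def_b Myb in nMyx.
have outy d : M y d -> d \in [:: y; z; w].
  move=> Myd; apply: (le3_mem (out3 y)); rewrite ?inE //=.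
  by rewrite !inE negb_or eq_sym zy eq_sym wy eq_sym wz.
have Mzx : M z x.
  have [b [/negPf b_z Mzb /outx]] := Mout zx (Mrefl z) Mxz.
  rewrite !inE b_z orbF => /orP[]/eqP def_b; first by rewrite -def_b.
  by rewrite -def_b Mzb in nMzy.
have Mzw : M z w.
  have [b [/negPf b_z Mzb /outy]] := Mout zy (Mrefl z) Myz.
  rewrite !inE b_z /= => /orP[]/eqP def_b; last by rewrite -def_b.
  by rewrite -def_b Mzb in nMzy.
constructor 3; exists z, w; split=> //; rewrite /= !inE !negb_or xy.
by rewrite [x == z]eq_sym zx [x == w]eq_sym wx [y == z]eq_sym zy
  [y == w]eq_sym wy eq_sym wz.
Qed.

End LocalStructure.

(** * Merging orbits of a permutation by rearranging a few images *)

Section Orbits.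

Variable T : finType.

(** Up to the first visit to [k], the [f]-walk from [f x] avoids [K], so [g] follows it: passing
    through [x] would restart the walk and give an earlier visit to [k]. *)
Lemma fconnect_first_return (f g : T -> T) (K : pred T) x k :
    (forall u, fconnect f (f x) u -> K u -> u = x \/ u = k) ->
    (forall u, ~~ K u -> g u = f u) ->
  fconnect f (f x) k -> fconnect g (f x) k.
Proof.
move=> hitK eq_fg fxk.
have ex_j : exists j, iter j f (f x) == k.
  by exists (findex f (f x) k); rewrite iter_findex.
case: (ex_minnP ex_j) => j /eqP def_k min_j.
suff eq_iter i : i <= j -> iter i g (f x) = iter i f (f x).
  by rewrite -def_k -eq_iter // fconnect_iter.
elim: i => //= i IHi lt_ij; rewrite IHi 1?ltnW //; apply: eq_fg.
apply/negP=> Ki; have [def_x | def_k'] := hitK _ (fconnect_iter f i (f x)) Ki.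
  have /min_j : iter (j - i.+1) f (f x) == k.
    by rewrite -iterSr -[x in iter _ f x]def_x -iterD addSn -addnS subnK ?def_k.
  by rewrite leqNgt ltn_subrL (leq_trans _ lt_ij).
by have /min_j := introT eqP def_k'; rewrite leqNgt lt_ij.
Qed.

Implicit Types s : {perm T}.

Lemma fconnect_perm_step s x y : s x = y -> fconnect s x y.
Proof. by move<-; apply: fconnect1. Qed.

Lemma fconnect_permC s x y : fconnect s x y = fconnect s y x.
Proof. exact/fconnect_sym/perm_inj. Qed.

(** The [s]-walk from [s x] returns to [x] without meeting [y], and vice versa, so [s'] traverses
    one old orbit and then the other. The first conclusion ensures that no connected pair is
    lost. *)
Lemma fconnect_tperm s x y (s' := (tperm x y * s)%g) :
    ~~ fconnect s x y ->
  (forall u, fconnect s' u (s u)) /\ fconnect s' x y.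
Proof.
move=> nxy; have step := @fconnect_perm_step s'.
have ret u v : pred2 x y u -> pred2 x y v -> u != v -> ~~ fconnect s u v ->
    fconnect s' (s u) u.
  move=> Ku Kv uv nuv; apply: (@fconnect_first_return s s' (pred2 x y)).
  - move=> w; rewrite -(same_fconnect1 (@perm_inj _ s)) => uw Kw; left.
    have : w != v by apply: contraNneq nuv => <-.
    move: Ku Kv uv Kw => /= /orP[]/eqP-> /orP[]/eqP->; rewrite ?eqxx //.
      by move=> _ /orP[]/eqP->; rewrite ?eqxx.
    by move=> _ /orP[]/eqP->; rewrite ?eqxx.
  - move=> w /norP[wx wy]; rewrite permM tpermD // eq_sym //.
  - by rewrite -(same_fconnect1 (@perm_inj _ s)).
have xNy : x != y by apply: contraNneq nxy => ->.
have sxx : fconnect s' (s x) x by apply: (ret x y); rewrite /= ?eqxx ?orbT.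
have syy : fconnect s' (s y) y.
  by apply: (ret y x); rewrite /= ?eqxx ?orbT 1?eq_sym 1?fconnect_permC.
have xsy : fconnect s' x (s y) by apply: step; rewrite permM tpermL.
have ysx : fconnect s' y (s x) by apply: step; rewrite permM tpermR.
have xy := connect_trans xsy syy; split=> // u.
have [-> | ux] := eqVneq u x; first exact: connect_trans xy ysx.
have [-> | uy] := eqVneq u y.
  exact: connect_trans (connect_trans ysx sxx) xsy.
by apply: step; rewrite permM tpermD // eq_sym.
Qed.

(** Products of permutations apply from left to right, so for distinct points this is the 4-cycle
    [x], [y], [z], [w]. *)
Definition rot4 x y z w : {perm T} := (tperm z w * tperm y z * tperm x y)%g.

Lemma rot4E x y z w (r := rot4 x y z w) : uniq [:: x; y; z; w] ->
  [/\ r x = y, r y = z, r z = w, r w = x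
    & forall u, u \notin [:: x; y; z; w] -> r u = u].
Proof.
rewrite /= !inE !negb_or => /and4P[/and3P[xy xz xw] /andP[yz yw] zw _].
rewrite /r /rot4; split=> [||||u].
- by rewrite !permM (@tpermD _ z w x) 1?eq_sym // (@tpermD _ y z x) 1?eq_sym //
    tpermL.
- by rewrite !permM (@tpermD _ z w y) 1?eq_sym // tpermL tpermD.
- by rewrite !permM tpermL (@tpermD _ y z w) // (@tpermD _ x y w).
- by rewrite !permM !tpermR.
rewrite !inE !negb_or => /and4P[ux uy uz uw].
by rewrite !permM (@tpermD _ z w u) 1?eq_sym // (@tpermD _ y z u) 1?eq_sym //
  (@tpermD _ x y u) 1?eq_sym.
Qed.

(* Following [s] from any of the four points, the next one of them to be met is
   its partner ([z] for [x], [w] for [y]); hence [s'] meets them in the cyclic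
   order [x, w, z, y]. *)
Lemma fconnect_rot4 s x y z w (s' := (rot4 x y z w * s)%g) :
    uniq [:: x; y; z; w] -> fconnect s x z -> fconnect s y w ->
    ~~ fconnect s x y ->
  (forall u, fconnect s' u (s u)) /\ fconnect s' x y.
Proof.
move=> xyzw xz yw nxy; have [rx ry rz rw rD] := rot4E xyzw.
have step u v : rot4 x y z w u = v -> fconnect s' u (s v).
  by move=> def_v; apply: fconnect_perm_step; rewrite permM def_v.
have cs := fconnect_permC s.
have nconn u v : fconnect s x u -> fconnect s y v -> ~~ fconnect s u v.
  move=> xu yv; apply: contra nxy => uv.
  by rewrite (connect_trans xu) // (connect_trans uv) // cs.
have ret u v : fconnect s u v ->
    (forall t, t \in [:: x; y; z; w] -> fconnect s u t -> t = u \/ t = v) ->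
    fconnect s' (s u) v.
  move=> uv hit; apply: (@fconnect_first_return s s' (mem [:: x; y; z; w])).
  - by move=> t; rewrite -(same_fconnect1 (@perm_inj _ s)) => ut Kt; apply: hit.
  - by move=> t nKt; rewrite permM rD.
  - by rewrite -(same_fconnect1 (@perm_inj _ s)).
have hitA u t : fconnect s x u -> t \in [:: x; y; z; w] -> fconnect s u t ->
    t = x \/ t = z.
  rewrite !inE => xu /or4P[]/eqP-> ut; [by left | | by right | ].
    by case/negP: (nconn u y xu (connect0 _ _)).
  by case/negP: (nconn u w xu yw).
have hitB u t : fconnect s y u -> t \in [:: x; y; z; w] -> fconnect s u t ->
    t = y \/ t = w.
  rewrite !inE => yu /or4P[]/eqP-> ut; [ | by left | | by right].
    by case/negP: (nconn x u (connect0 _ _) yu); rewrite cs.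
  by case/negP: (nconn z u xz yu); rewrite cs.
have zx : fconnect s z x by rewrite cs.
have wy : fconnect s w y by rewrite cs.
have x_z : fconnect s' (s x) z.
  by apply: ret xz _ => t; apply: hitA.
have z_x : fconnect s' (s z) x.
  by apply: ret zx _ => t Kt zt; apply/or_comm/(hitA z t xz Kt zt).
have y_w : fconnect s' (s y) w.
  by apply: ret yw _ => t; apply: hitB.
have w_y : fconnect s' (s w) y.
  by apply: ret wy _ => t Kt wt; apply/or_comm/(hitB w t yw Kt wt).
have xTw := connect_trans (step _ _ rx) y_w.
have wTz := connect_trans (step _ _ rw) x_z.
have zTy := connect_trans (step _ _ rz) w_y.
have yTx := connect_trans (step _ _ ry) z_x.
have xTz := connect_trans xTw wTz; have xTy := connect_trans xTz zTy.
have cs' := fconnect_permC s'; split=> // u.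
have [] := boolP (u \in [:: x; y; z; w]); last first.
  by move=> nKu; apply: step; rewrite rD.
have from_x v t : fconnect s' x v -> fconnect s' x (s t) ->
    fconnect s' v (s t).
  by rewrite cs'; apply: connect_trans.
rewrite !inE => /or4P[]/eqP->; apply: from_x => //.
- exact: connect_trans xTw (step _ _ rw).
- exact: step.
- exact: connect_trans xTy (step _ _ ry).
- exact: connect_trans xTz (step _ _ rz).
Qed.

End Orbits.

(** * Hamiltonicity from a cycle factor of maximal connectivity *)

Theorem theorem2p3 (T : finType) (e : rel T)
  (e_irr : irreflexive e)
  (T_ge2 : 2 <= #|T|)
  (e_strong : strong e)
  (e_quad : s_quadrangular e)
  (out_le3 : forall x : T, #|out_nbr e x| <= 3)
  (in_le3 : forall x : T, #|in_nbr e x| <= 3) :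
  hamiltonian e.
Proof.
have [quad_out quad_in] := e_quad.
have out_n0 x : out_nbr e x != set0.
  have [y yx] : exists y, y != x.
    have /card_gt1P[a [b [_ _ ab]]] := T_ge2.
    have [ax | ] := eqVneq a x; last by exists a.
    by exists b; rewrite -ax eq_sym.
  have /connectP[[|z p] /= xp def_y] := e_strong x y.
    by rewrite def_y eqxx in yx.
  by case/andP: xp => xz _; apply/set0Pn; exists z; rewrite inE.
have [f f_inj fE] := hall (quadrangular_hall quad_out out_n0).
pose factor (s : {perm T}) := [forall x, e x (s x)].
pose conn (s : {perm T}) := [set p : T * T | fconnect s p.1 p.2].
have factor_f : factor (perm f_inj).
  by apply/forallP=> x; rewrite permE; have := fE x; rewrite inE.
case: (arg_maxnP (fun s => #|conn s|) factor_f) => s /forallP es max_s.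
(* A factor [s'] whose orbits contain all steps of [s] connects every pair that [s] does; by
   maximality it connects no others. *)
have maximal s' x y : factor s' -> (forall u, fconnect s' u (s u)) ->
    fconnect s' x y -> fconnect s x y.
  move=> es' ss' s'xy.
  have sub : conn s \subset conn s'.
    apply/subsetP=> -[u v]; rewrite !inE /=; apply: connect_sub => {}u {}v.
    by move/eqP<-.
  have /eqP eq_s : conn s == conn s' by rewrite eqEcard sub; apply: max_s.
  have : (x, y) \in conn s by rewrite eq_s inE.
  by rewrite inE.
pose M := [rel x y | e x (s y)].
have swap x y : M x y -> M y x -> fconnect s x y.
  move=> /= Mxy Myx; apply/negPn/negP=> nxy; case/negP: (nxy).
  have [ss' xy] := fconnect_tperm nxy; apply: maximal ss' xy.
  (* [M x y] and [M y x] are the arcs needed at the two swapped points. *)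
  by apply/forallP=> u; rewrite permM; case: tpermP => [->|->|].
have Mout x y a : x != y -> M x a -> M y a ->
    exists b, [/\ b != a, M x b & M y b].
  move=> xy Mxa Mya.
  have [||b [ba]] := quadrangular_second_common quad_out (a := s a) xy.
  - by rewrite inE.
  - by rewrite inE.
  rewrite !inE => xb yb; exists (s^-1%g b); rewrite /= permKV; split=> //.
  by apply: contraNneq ba => <-; rewrite permKV.
have Min x y a : x != y -> M a x -> M a y ->
    exists b, [/\ b != a, M b x & M b y].
  move=> xy Max May; have sxy : s x != s y by rewrite (inj_eq perm_inj).
  have [||b [ba]] := quadrangular_second_common quad_in (a := a) sxy.
  - by rewrite inE.
  - by rewrite inE.
  by rewrite !inE => bx by_; exists b.
have Mout3 x : #|[set y | M x y]| <= 3.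
  rewrite -(card_imset _ (@perm_inj _ s)).
  apply: leq_trans (out_le3 x); apply/subset_leq_card/subsetP.
  by move=> _ /imsetP[y + ->]; rewrite !inE.
have Min3 x : #|[set y | M y x]| <= 3 by apply: in_le3.
have Mconn x y : M x y -> fconnect s x y.
  move=> Mxy; have := subcubic_quadrangular_arc es Mout3 Min3 Mout Min Mxy.
  case=> [Myx | [z [Mxz Mzx Myz Mzy]] | ].
  - exact: swap.
  - exact: connect_trans (swap x z Mxz Mzx) (swap z y Mzy Myz).
  case=> z [w [xyzw [Mxz Mzx] [Myw Mwy] [Myz Mzw Mwx]]].
  apply/negPn/negP=> nxy; case/negP: (nxy).
  have [ss' xy] := fconnect_rot4 xyzw (swap x z Mxz Mzx) (swap y w Myw Mwy) nxy.
  (* The 4-cycle of arcs of [M] through [x], [y], [z], [w] makes the rotated permutation a factor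
     again. *)
  apply: maximal ss' xy; apply/forallP=> u; rewrite permM.
  have [rx ry rz rw rD] := rot4E xyzw.
  have [] := boolP (u \in [:: x; y; z; w]); last by move=> nKu; rewrite rD.
  by rewrite !inE => /or4P[]/eqP->; rewrite ?rx ?ry ?rz ?rw.
have all_conn x y : fconnect s x y.
  suff sub : subrel (connect e) (fconnect s) by apply/sub/e_strong.
  apply: connect_sub => {}x {}y exy; have : M x (s^-1%g y) by rewrite /= permKV.
  move/Mconn/connect_trans; apply; apply: fconnect_perm_step.
  by rewrite permKV.
have /card_gt0P[x _] : 0 < #|T| by apply: ltnW.
exists (orbit s x); split; last by move=> y; rewrite -fconnect_orbit.
  have := cycle_orbit (@perm_inj _ s) x; apply: sub_cycle => u v /eqP<-.
  exact: es.
exact: orbit_uniq.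
Qed.
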